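(* Let $\mu_k>10$. Then for all even $N>2\mu_k$ (so the bounds are uniform in $N$) the following hold: $$\|T_k^{-1}\|_1\le0.806+\tfrac1{20}\ \text{ if }\mu_k>10,\qquad \|T_k^{-1}\|_1\le0.736+\tfrac1{200}\ \text{ if }\mu_k>100,\qquad \|T_k^{-1}\|_1\le0.727+\tfrac1{2000}\ \text{ if }\mu_k>1000.$$
   Context: $\mu_k$ is a real number and $N$ a positive even integer. $T_k$ is the $N\times N$ tridiagonal matrix with diagonal entries $(T_k)_{j,j}=2j$, $1\le j\le N$, superdiagonal entries $(T_k)_{j,j+1}=-\mu_k$ and subdiagonal entries $(T_k)_{j+1,j}=\mu_k$. It is invertible. For an $N\times N$ matrix $A$, $\|A\|_1=\max_i\sum_{j=1}^N|A_{ij}|$. *)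

(* Defs.v *)
From mathcomp Require Import all_boot all_order all_algebra.
From mathcomp Require Import reals.

Set Implicit Arguments.
Unset Strict Implicit.
Unset Printing Implicit Defensive.

Import Order.TTheory GRing.Theory Num.Theory.
Local Open Scope ring_scope.

(* Indices are 0-based: the 1-based diagonal entry 2j is 2(i+1) at i = j - 1. *)
Definition Tmx (R : realType) (mu : R) (N : nat) : 'M[R]_N :=
  \matrix_(i < N, j < N)
    if j == i :> nat then (2 * i.+1)%:R
    else if j == i.+1 :> nat then - mu
    else if i == j.+1 :> nat then mu
    else 0.

(* The maximum over the rows of the absolute row sums.  The initial value 0 of
   the fold matters only when N = 0, as the row sums are nonnegative. *)
Definition norm1 (R : realType) (N : nat) (A : 'M[R]_N) : R :=
  \big[Num.max/0]_(i < N) \sum_(j < N) `|A i j|.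

(* [invmx A] is the inverse of [A] only when [A \in unitmx]. *)
Lemma Tmx_unit (R : realType) (mu : R) (N : nat) : Tmx mu N \in unitmx.
Proof.
rewrite -row_free_unit -kermx_eq0; apply/eqP/row_matrixP => k.
rewrite row0; set v := row k _.
have vT0 : v *m Tmx mu N = 0 by rewrite /v -row_mul mulmx_ker row0.
have q0 : (v *m (Tmx mu N + (Tmx mu N)^T) *m v^T) 0 0 = 0.
  rewrite mulmxDr vT0 add0r -mulmxA -trmx_mul.
  by rewrite vT0 trmx0 mulmx0 mxE.
have TD : Tmx mu N + (Tmx mu N)^T = diag_mx (\row_(i < N) (4 * i.+1)%:R).
  apply/matrixP => i j; rewrite !mxE (eq_sym (nat_of_ord i) j).
  rewrite (eq_sym i j) -val_eqE /=.
  have [ji|ji] := eqVneq (nat_of_ord j) i.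
    by rewrite mulr1n ji -natrD -mulnDl.
  rewrite mulr0n.
  have [E|_] := eqVneq (nat_of_ord j) i.+1.
    by rewrite E ltn_eqF ?addNr // ltnS leqnSn.
  by case: eqP => _; rewrite ?subrr ?addr0.
move: q0; rewrite TD mul_mx_diag mxE => q0.
have ge0 (i : 'I_N) : 0 <= v 0 i * (4 * i.+1)%:R * v 0 i.
  by rewrite mulrAC -expr2 mulr_ge0 ?sqr_ge0.
apply/rowP => i; rewrite [RHS]mxE.
have /psumr_eq0P/(_ i isT) : \sum_(i < N) v 0 i * (4 * i.+1)%:R * v 0 i = 0.
  by rewrite -[RHS]q0; apply: eq_bigr => j _; rewrite !mxE.
move=> /(_ (fun j _ => ge0 j))/eqP.
by rewrite !mulf_eq0 pnatr_eq0 muln_eq0 /= orbF orbb => /eqP.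
Qed.

(* Main.v *)
Require Import Defs.
From mathcomp Require Import all_boot all_order all_algebra.
From mathcomp Require Import reals.
From mathcomp Require Import zify ring lra.

(** All three bounds follow from a single one: every row of the inverse has
    absolute sum at most 0.7275 as soon as mu > 10 and N > 2 mu.

    Fix a row p of the inverse and write y_1, ..., y_N for its entries, with
    y_0 = y_(N+1) = 0.  Multiplying by T gives the recurrence
      2 j y_j - mu y_(j-1) + mu y_(j+1) = [j = p].
    T is a positive diagonal matrix plus a skew-symmetric one, and multiplying
    the recurrence by y_j shows that the products y_j y_(j+1) are nonpositive to
    the left of p and nonnegative to its right.  Hence v = |y| satisfies a
    recurrence of the same kind with no cancellation: each 2 j v_j with j <> p
    is mu times a difference of v_(j-1) and v_(j+1), and at the peak
      2 p v_p + mu v_(p-1) + mu v_(p+1) <= 1.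
    Telescoping these differences yields two global estimates,
      sum_j 2 j v_j^2 <= v_p          ([profile_energy]),
      sum_j 2 j v_j   <= 2 mu v_p + 1 ([profile_moment]).
    The first controls the entries of small index, where the row might be
    large, and the second the far entries, uniformly in N.

    Both depend on the size of v_p.  If 2 p > mu the peak relation gives
    mu v_p <= 1.  Otherwise v_p could only be much larger than 1 / mu if v_(p+1)
    were much smaller than v_p, and this is excluded by coupling the two parity
    classes over a window of 2 k indices to the right of p: with
    a = 2 k (p + k) / mu,
      v_p - v_(p+2k) <= a v_(p+1)   and   a v_(p+2k) <= v_(p+1),
    so that v_p <= (a + 1/a) v_(p+1) <= (a + 1/a) / mu.  A window with
    1/2 <= a <= 3/2 exists and stays inside the matrix because N > 2 mu
    ([hop_length]); hence mu v_p <= 5/2 ([profile_peak_small]).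

    Finally the arithmetic-geometric inequality splits v_j into a part
    proportional to j v_j, a part 2 j v_j^2 and a constant that vanishes for
    j >= 12 ([weighted_AMGM]).  Summing over j gives
      (2 * 5/2 + 1) / 24 + (5/2) / 10 + 0.206 = 0.706 ([profile_mass]). *)

Set Implicit Arguments.
Unset Strict Implicit.
Unset Printing Implicit Defensive.

Import Order.TTheory GRing.Theory Num.Theory.
Local Open Scope ring_scope.

(** * Absolute values of a row of the inverse *)

(** Indices of [v] are those of the informal numbering from 1, with a zero
    boundary value on each side; the peak, which is the diagonal entry of the
    row, sits at [q.+1]. *)
Record green_profile (R : realType) (mu : R) (N q : nat) (v : nat -> R) : Prop :=
  GreenProfile {
    profile_ge0 : forall j, 0 <= v j;
    profile_first : v 0%N = 0;
    profile_last : v N.+1 = 0;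
    profile_left : forall j, (j < q)%N ->
      mu * (v j.+2 - v j) = 2 * j.+1%:R * v j.+1;
    profile_peak : 2 * q.+1%:R * v q.+1 + mu * v q + mu * v q.+2 <= 1;
    profile_right : forall j, (q < j < N)%N ->
      mu * (v j - v j.+2) = 2 * j.+1%:R * v j.+1 }.

Lemma normrD_same_sign (R : realType) (x y : R) :
  0 <= x * y -> `|x + y| = `|x| + `|y|.
Proof.
have [x0|x0|->] := ltgtP x 0; last by rewrite normr0 !add0r.
  rewrite nmulr_rge0 // => y0.
  by rewrite (ltr0_norm x0) (ler0_norm y0) ler0_norm ?opprD //; lra.
rewrite pmulr_rge0 // => y0.
by rewrite (gtr0_norm x0) (ger0_norm y0) ger0_norm // addr_ge0 // ltW.
Qed.

Section Profile.
Variables (R : realType) (mu : R) (N q : nat).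
Hypotheses (mu0 : 0 < mu) (qN : (q < N)%N).

Section Signs.
Variable y : nat -> R.
Hypotheses (y_first : y 0%N = 0) (y_last : y N.+1 = 0).
Hypothesis y_eq : forall j, (j < N)%N ->
  2 * j.+1%:R * y j.+1 - mu * y j + mu * y j.+2 = (j == q)%:R.

(** The increment of mu * y_j * y_(j+1) at a step is minus 2 (j+1) y_(j+1)^2, and
    the product starts from 0 at the left boundary. *)
Lemma left_signs j : (j <= q)%N -> y j * y j.+1 <= 0.
Proof.
elim: j => [|j IH] jq; first by rewrite y_first mul0r.
have := y_eq (leq_trans jq (ltnW qN)); rewrite ltn_eqF //= => E.
have {}IH := IH (ltnW jq).
have S : mu * (y j.+1 * y j.+2) = mu * (y j * y j.+1) - 2 * j.+1%:R * y j.+1 ^+ 2.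
  have {}E : mu * y j.+2 = mu * y j - 2 * j.+1%:R * y j.+1 by lra.
  by rewrite mulrCA E; ring.
have c0 : 0 <= 2 * j.+1%:R * y j.+1 ^+ 2 by rewrite mulr_ge0 ?sqr_ge0 // mulr_ge0.
rewrite -(pmulr_rle0 _ mu0) S subr_le0.
by apply: le_trans c0; rewrite pmulr_rle0.
Qed.

(** The mirror argument, run downwards from the right boundary. *)
Lemma right_signs j : (q < j <= N)%N -> 0 <= y j * y j.+1.
Proof.
case/andP=> qj /subnKC; move: (N - j)%N => d; elim: d j qj => [|d IH] j qj.
  by rewrite addn0 => ->; rewrite y_last mulr0.
rewrite addnS -addSn => jN.
have {}IH := IH j.+1 (leqW qj) jN.
have jN' : (j < N)%N by rewrite -jN leq_addr.
have := y_eq jN'; rewrite gtn_eqF //= => E.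
have S : mu * (y j * y j.+1) = mu * (y j.+1 * y j.+2) + 2 * j.+1%:R * y j.+1 ^+ 2.
  have {}E : mu * y j = mu * y j.+2 + 2 * j.+1%:R * y j.+1 by lra.
  by rewrite mulrA E; ring.
rewrite -(pmulr_rge0 _ mu0) S; apply: addr_ge0; first by rewrite pmulr_rge0.
by rewrite mulr_ge0 ?sqr_ge0 // mulr_ge0.
Qed.

Lemma abs_left j : (j < q)%N ->
  mu * (`|y j.+2| - `|y j|) = 2 * j.+1%:R * `|y j.+1|.
Proof.
move=> jq; have := y_eq (ltn_trans jq qN); rewrite ltn_eqF //= => E.
have c0 : 0 <= 2 * j.+1%:R :> R by rewrite mulr_ge0.
have -> : 2 * j.+1%:R * `|y j.+1| = `|- (2 * j.+1%:R * y j.+1)|.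
  by rewrite normrN normrM (ger0_norm c0).
have -> : mu * (`|y j.+2| - `|y j|) = `|mu * y j.+2| - `|mu * y j|.
  by rewrite !normrM (gtr0_norm mu0) mulrBr.
have -> : mu * y j.+2 = mu * y j + - (2 * j.+1%:R * y j.+1) by lra.
rewrite normrD_same_sign; first by ring.
have -> : mu * y j * - (2 * j.+1%:R * y j.+1) =
   mu * (2 * j.+1%:R) * - (y j * y j.+1) by ring.
apply: mulr_ge0; first by rewrite mulr_ge0 // ltW.
by rewrite oppr_ge0 left_signs // ltnW.
Qed.

Lemma abs_right j : (q < j < N)%N ->
  mu * (`|y j| - `|y j.+2|) = 2 * j.+1%:R * `|y j.+1|.
Proof.
case/andP=> qj jN; have := y_eq jN; rewrite gtn_eqF //= => E.
have c0 : 0 <= 2 * j.+1%:R :> R by rewrite mulr_ge0.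
have -> : 2 * j.+1%:R * `|y j.+1| = `|2 * j.+1%:R * y j.+1|.
  by rewrite normrM (ger0_norm c0).
have -> : mu * (`|y j| - `|y j.+2|) = `|mu * y j| - `|mu * y j.+2|.
  by rewrite !normrM (gtr0_norm mu0) mulrBr.
have -> : mu * y j = mu * y j.+2 + 2 * j.+1%:R * y j.+1 by lra.
rewrite normrD_same_sign; first by ring.
have -> : mu * y j.+2 * (2 * j.+1%:R * y j.+1) =
   mu * (2 * j.+1%:R) * (y j.+1 * y j.+2) by ring.
apply: mulr_ge0; first by rewrite mulr_ge0 // ltW.
by apply: right_signs; rewrite jN ltnW.
Qed.

(** Multiplied by y_(q+1), the equation at the peak has only nonnegative terms,
    which forces y_(q+1) to be nonnegative and fixes the signs of its two
    neighbours.  When y_(q+1) = 0 those signs are undetermined, but then the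
    neighbours vanish as well. *)
Lemma abs_peak :
  2 * q.+1%:R * `|y q.+1| + mu * `|y q| + mu * `|y q.+2| <= 1.
Proof.
have := y_eq qN; rewrite eqxx /= mulr1n => E.
have c0 n : 0 < 2 * n.+1%:R :> R by rewrite mulr_gt0.
have [y0|yn0] := eqVneq (y q.+1) 0.
  have left0 : `|y q| = 0.
    case: (q) abs_left y0 => [|r] L y0; first by rewrite y_first normr0.
    apply/eqP; rewrite -normr_le0 normr_id -(pmulr_rle0 _ (c0 r)) -L //.
    by rewrite y0 normr0 sub0r pmulr_rle0 // oppr_le0 normr_ge0.
  have right0 : `|y q.+2| = 0.
    have [qN'|] := ltnP q.+1 N; last first.
      move=> Nq; have -> : q.+2 = N.+1 by lia.
      by rewrite y_last normr0.
    apply/eqP; rewrite -normr_le0 normr_id -(pmulr_rle0 _ (c0 q.+1)).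
    rewrite -abs_right ?ltnSn // y0 normr0 sub0r.
    by rewrite pmulr_rle0 // oppr_le0 normr_ge0.
  by rewrite y0 left0 right0 normr0 !mulr0 !addr0 ler01.
have L := left_signs (leqnn q).
have Rt : 0 <= y q.+1 * y q.+2 by apply: right_signs; rewrite ltnSn.
have S : y q.+1 = 2 * q.+1%:R * y q.+1 ^+ 2 - mu * (y q * y q.+1) +
                  mu * (y q.+1 * y q.+2).
  by have /= := congr1 (fun z => z * y q.+1) E; rewrite mul1r; lra.
have yp : 0 < y q.+1.
  rewrite lt0r yn0 S; apply: addr_ge0; last by rewrite pmulr_rge0.
  apply: addr_ge0; last by rewrite oppr_ge0 pmulr_rle0.
  by rewrite mulr_ge0 ?sqr_ge0 // ltW.
move: L Rt; rewrite pmulr_lle0 // pmulr_rge0 // => L Rt.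
rewrite (gtr0_norm yp) (ler0_norm L) (ger0_norm Rt).
lra.
Qed.

Lemma abs_profile : green_profile mu N q (fun j => `|y j|).
Proof.
split=> //=.
- by rewrite y_first normr0.
- by rewrite y_last normr0.
- exact: abs_left.
- exact: abs_peak.
- exact: abs_right.
Qed.

End Signs.

Variable v : nat -> R.
Hypothesis vP : green_profile mu N q v.
Let v_ge0 := profile_ge0 vP.

(** * Energy and first moment *)

Lemma split_at_peak (F : nat -> R) : \sum_(0 <= j < N) F j =
  \sum_(0 <= j < q) F j + F q + \sum_(q.+1 <= j < N) F j.
Proof.
by rewrite (big_cat_nat (n := q.+1)) //= big_nat_recr.
Qed.

(** The summand is the increment of mu * v_j * v_(j+1) to the left of the peak
    and its decrement to the right; the boundary values kill the outer ends, and the inner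
    ends are collected by the peak relation multiplied by v_(q+1). *)
Lemma profile_energy :
  \sum_(0 <= j < N) 2 * j.+1%:R * v j.+1 ^+ 2 <= v q.+1.
Proof.
rewrite split_at_peak.
rewrite (eq_big_nat _ _ (F2 := fun j => mu * (v j.+1 * v j.+2) - mu * (v j * v j.+1))).
  rewrite telescope_sumr // (profile_first vP).
  rewrite (eq_big_nat _ _ (F1 := fun j => 2 * j.+1%:R * v j.+1 ^+ 2)
    (F2 := fun j => - (mu * (v j.+1 * v j.+2)) - (- (mu * (v j * v j.+1))))).
    rewrite (telescope_sumr (fun j => - (mu * (v j * v j.+1)))) //.
    rewrite (profile_last vP).
    have := ler_wpM2r (v_ge0 q.+1) (profile_peak vP).
    by rewrite mul1r; lra.
  move=> j jr; have := profile_right vP jr => E.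
  by rewrite expr2 mulrA -E; ring.
move=> j /andP[_ jr]; have := profile_left vP jr => E.
by rewrite expr2 mulrA -E; ring.
Qed.

(** The same telescoping, with mu * (v_j + v_(j+1)). *)
Lemma profile_moment :
  \sum_(0 <= j < N) 2 * j.+1%:R * v j.+1 <= 2 * (mu * v q.+1) + 1.
Proof.
rewrite split_at_peak.
rewrite (eq_big_nat _ _ (F2 := fun j => mu * (v j.+1 + v j.+2) - mu * (v j + v j.+1))).
  rewrite telescope_sumr // (profile_first vP).
  rewrite (eq_big_nat _ _ (F1 := fun j => 2 * j.+1%:R * v j.+1)
    (F2 := fun j => - (mu * (v j.+1 + v j.+2)) - (- (mu * (v j + v j.+1))))).
    rewrite (telescope_sumr (fun j => - (mu * (v j + v j.+1)))) //.
    rewrite (profile_last vP).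
    have h1 : 0 <= mu * v 1%N by rewrite mulr_ge0 // ltW.
    have hN : 0 <= mu * v N by rewrite mulr_ge0 // ltW.
    by have := profile_peak vP; lra.
  move=> j jr; have := profile_right vP jr => E.
  by rewrite -E; ring.
move=> j /andP[_ jr]; have := profile_left vP jr => E.
by rewrite -E; ring.
Qed.

(** * Size of the diagonal entry *)

Lemma right_nonincreasing j : (q < j < N)%N -> v j.+2 <= v j.
Proof.
move=> jr; have := profile_right vP jr => E.
by rewrite -subr_ge0 -(pmulr_rge0 _ mu0) E !mulr_ge0.
Qed.

(** Going from [q.+1] to [q.+1 + 2 k], the value drops by multiples of the
    entries of the other parity, each of which is at most v_(q+2). *)
Lemma same_parity_drop k : (q.+1 + k.*2 <= N)%N ->
  mu * (v q.+1 - v (q.+1 + k.*2)) <= 2 * (k * (q.+1 + k))%:R * v q.+2 /\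
  v (q.+2 + k.*2) <= v q.+2.
Proof.
elim: k => [|k IH]; first by rewrite !addn0 subrr mul0n !mulr0 mul0r.
rewrite doubleS !addnS => kN.
have [|IH1 IH2] := IH; first lia.
have mono := @right_nonincreasing (q.+2 + k.*2) ltac:(lia).
have E := profile_right vP (j := q.+1 + k.*2) ltac:(lia).
have := ler_wpM2l (mulr_ge0 (ler0n R 2) (ler0n R (q + k.*2).+2)) IH2.
move: IH1 IH2 mono E; rewrite !addSn => IH1 IH2 mono E.
rewrite -E => H; split; last exact: le_trans mono IH2.
have -> : 2 * (k.+1 * (q + k).+2)%:R =
    2 * (k * (q + k).+1)%:R + 2 * (q + k.*2).+2%:R :> R.
  by rewrite -mulrDr -natrD; congr (_ * _%:R); lia.
lra.
Qed.

(** Conversely v_(q+2) exceeds v_(q+2+2k) by multiples of the entries of the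
    parity of the peak, each of which is at least v_(q+1+2k). *)
Lemma next_parity_growth k : (q.+1 + k.*2 <= N)%N ->
  2 * (k * (q.+2 + k))%:R * v (q.+1 + k.*2) <= mu * (v q.+2 - v (q.+2 + k.*2)).
Proof.
elim: k => [|k IH]; first by rewrite !addn0 subrr mul0n !mulr0 mul0r.
rewrite doubleS !addnS => kN.
have {}IH := IH ltac:(lia).
have mono := @right_nonincreasing (q.+1 + k.*2) ltac:(lia).
have E := profile_right vP (j := q.+2 + k.*2) ltac:(lia).
have c0 : 0 <= 2 * (k * (q.+2 + k))%:R :> R by rewrite mulr_ge0.
have := ler_wpM2l c0 mono.
move: IH E; rewrite !addSn => IH E H.
have -> : 2 * (k.+1 * (q + k).+3)%:R =
    2 * (k * (q + k).+2)%:R + 2 * (q + k.*2).+3%:R :> R.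
  by rewrite -mulrDr -natrD; congr (_ * _%:R); lia.
lra.
Qed.

(** The least k that satisfies the lower bound also satisfies the upper one:
    passing from k - 1 to k multiplies k (q+1+k) by at most 3 when k >= 2, and
    for k = 1 the product is small because 2 (q+1) <= mu. *)
Lemma hop_length : 10 < mu -> 2 * q.+1%:R <= mu -> 2 * mu < N%:R ->
  exists2 k, (q.+1 + k.*2 <= N)%N & mu <= (4 * (k * (q.+1 + k)))%:R <= 3 * mu.
Proof.
move=> mu10 qmu muN.
have Pex : exists k, mu <= (4 * (k * (q.+1 + k)))%:R.
  exists N; apply: (@le_trans _ _ N%:R); first lra.
  by rewrite ler_nat; nia.
case: (ex_minnP Pex) => -[|[|k]] Pk kmin; first by move: Pk; lra.
- exists 1%N; last rewrite Pk /=.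
  + rewrite -(ler_nat R) -[(1.*2)%N]/2%N natrD; lra.
  + by move: Pk; rewrite !natrM natrD; lra.
have Pk1 : (4 * (k.+1 * (q.+1 + k.+1)))%:R < mu.
  by rewrite ltNge; apply/negP => /kmin; rewrite ltnn.
have ub : (4 * (k.+2 * (q.+1 + k.+2)))%:R <= 3 * mu.
  apply: (@le_trans _ _ (3 * (4 * (k.+1 * (q.+1 + k.+1)))%:R)).
    by rewrite -natrM ler_nat; nia.
  by rewrite ler_wpM2l // ltW.
exists k.+2; last by rewrite Pk.
(* k <= k (q+1+k) gives 4 k <= 3 mu, so the window ends before 2 mu < N. *)
have : (4 * k.+2)%:R <= (4 * (k.+2 * (q.+1 + k.+2)))%:R :> R.
  by rewrite ler_nat; nia.
rewrite -(ler_nat R) natrD -muln2 !(natrM _ _ k.+2) (natrM _ k.+2); lra.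
Qed.

(** The bound 5/2 is the value of a + 1/a at a = 1/2, which is its maximum for
    a between 1/2 and 2, where a = A / mu. *)
Lemma profile_peak_small : 10 < mu -> 2 * mu < N%:R -> mu * v q.+1 <= 5 / 2.
Proof.
move=> mu10 muN.
have vp := v_ge0 q.+1.
have peak := profile_peak vP.
have mvq : 0 <= mu * v q by rewrite mulr_ge0 // ltW.
have mvr : 0 <= mu * v q.+2 by rewrite mulr_ge0 // ltW.
have [qmu|qmu] := leP (2 * q.+1%:R) mu; last first.
  have := ler_wpM2r vp (ltW qmu); lra.
have [k kN /andP[klo khi]] := hop_length mu10 qmu muN.
have [drop _] := same_parity_drop kN.
have growth := next_parity_growth kN.
have mfar' : 0 <= mu * v (q.+2 + k.*2) by rewrite mulr_ge0 // ltW.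
set A : R := 2 * (k * (q.+1 + k))%:R in drop.
have AE : (4 * (k * (q.+1 + k)))%:R = 2 * A by rewrite /A [LHS]natrM; ring.
have {}growth : A * v (q.+1 + k.*2) <= mu * v q.+2.
  apply: le_trans (_ : mu * (v q.+2 - v (q.+2 + k.*2)) <= _); last lra.
  apply: le_trans growth; rewrite ler_wpM2r // /A ler_wpM2l // ler_nat.
  by rewrite leq_mul2l addSn leqnSn orbT.
rewrite AE in klo khi.
have A0 : 0 < A by lra.
have : A * (mu * v q.+1) <= A * (5 / 2 * (mu * v q.+2)).
  have h1 := ler_wpM2l (ltW A0) drop.
  have h2 := ler_wpM2l (ltW mu0) growth.
  (* This is a + 1/a <= 5/2, cleared of denominators. *)
  have h3 : 0 <= (A - mu / 2) * (2 * mu - A) * v q.+2.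
    by rewrite mulr_ge0 // mulr_ge0; lra.
  nra.
rewrite ler_pM2l // => h.
have : 0 <= 2 * q.+1%:R * v q.+1 by rewrite mulr_ge0 // mulr_ge0.
lra.
Qed.

(** * Summing the row *)

(** For index j = n + 1 < 12 the two sides differ by a positive multiple of a square.  The
    cutoff 12 balances the cost 1/12 of the moment term, which wants a large
    cutoff, against the sum of the constants, which grows with it like a
    logarithm. *)
Lemma weighted_AMGM (n : nat) (x : R) : 0 <= x ->
  x <= n.+1%:R / 12 * x + 2 * n.+1%:R * x ^+ 2 +
       (if (n < 11)%N then (1 - n.+1%:R / 12) ^+ 2 / (8 * n.+1%:R) else 0).
Proof.
move=> x0; set a : R := n.+1%:R; have a0 : 0 < a by rewrite ltr0n.
case: ifP => n11.
  rewrite -subr_ge0.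
  have -> : a / 12 * x + 2 * a * x ^+ 2 + (1 - a / 12) ^+ 2 / (8 * a) - x =
    (4 * a * x - (1 - a / 12)) ^+ 2 / (8 * a).
    by field; rewrite nat1r pnatr_eq0.
  by rewrite divr_ge0 ?sqr_ge0 // mulr_ge0 // ltW.
have a12 : 12 <= a by rewrite ler_nat; lia.
have : 0 <= 2 * a * x ^+ 2 by rewrite mulr_ge0 ?sqr_ge0 // mulr_ge0 // ltW.
have := ler_wpM2r x0 a12; lra.
Qed.

Lemma profile_mass : 10 < mu -> 2 * mu < N%:R ->
  \sum_(0 <= j < N) v j.+1 <= 7275 / 10000.
Proof.
move=> mu10 muN.
have N12 : (11 <= N)%N by rewrite ltnNge -(ler_nat R); apply/negP; lra.
have small := profile_peak_small mu10 muN.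
have moment := profile_moment; have energy := profile_energy.
pose c n : R :=
  if (n < 11)%N then (1 - n.+1%:R / 12) ^+ 2 / (8 * n.+1%:R) else 0.
have const : \sum_(0 <= j < N) c j <= 206 / 1000.
  rewrite (big_cat_nat (n := 11)) //= [X in _ + X]big_nat [X in _ + X]big1.
    by rewrite unlock /= /c /=; lra.
  by move=> j /andP[j11 _]; rewrite /c ltnNge j11.
apply: (@le_trans _ _ (24^-1 * \sum_(0 <= j < N) 2 * j.+1%:R * v j.+1 +
  \sum_(0 <= j < N) 2 * j.+1%:R * v j.+1 ^+ 2 + \sum_(0 <= j < N) c j)).
  rewrite mulr_sumr -!big_split /=; apply: ler_sum => j _.
  have := weighted_AMGM j (v_ge0 j.+1); rewrite -/(c j); lra.
have : 10 * v q.+1 <= mu * v q.+1 by rewrite ler_wpM2r // ltW.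
lra.
Qed.

End Profile.

(** * Rows of the inverse matrix *)

Section InverseRow.
Variables (R : realType) (mu : R) (N : nat) (i : 'I_N).

Definition inv_row_entry (j : nat) : R :=
  if j is l.+1 then
    if insub l is Some o then invmx (Tmx mu N) i o else 0
  else 0.

Lemma inv_row_entryE (o : 'I_N) : inv_row_entry o.+1 = invmx (Tmx mu N) i o.
Proof. by rewrite /= valK. Qed.

Lemma inv_row_entry_last : inv_row_entry N.+1 = 0.
Proof. by rewrite /= insubF ?ltnn. Qed.

(** Entry (i, j) of the identity T^-1 T = 1. *)
Lemma inv_row_eq j : (j < N)%N ->
  2 * j.+1%:R * inv_row_entry j.+1 - mu * inv_row_entry j
    + mu * inv_row_entry j.+2 = (j == i)%:R.
Proof.
move=> jN; set y := inv_row_entry.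
have yE : forall o : 'I_N, y o.+1 = invmx (Tmx mu N) i o := inv_row_entryE.
have y_first : y 0%N = 0 by [].
have y_last : y N.+1 = 0 := inv_row_entry_last.
clearbody y.
have /matrixP/(_ i (Ordinal jN)) := mulVmx (Tmx_unit mu N).
rewrite !mxE -val_eqE /= eq_sym => <-.
rewrite (eq_bigr (fun l : 'I_N =>
    (if l == j :> nat then 2 * j.+1%:R * y l.+1 else 0)
  + (if l.+1 == j :> nat then - (mu * y l.+1) else 0)
  + (if l == j.+1 :> nat then mu * y l.+1 else 0))); last first.
  move=> l _; rewrite -yE mxE /=.
  have [->|_] := eqVneq j l.
    by rewrite gtn_eqF // ltn_eqF // natrM; ring.
  rewrite eq_sym.
  have [lj|_] := eqVneq l.+1 j.
    by rewrite -lj [l == _ :> nat]ltn_eqF //; ring.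
  by case: ifP => _; ring.
rewrite !big_split /= -!big_mkcond /=.
rewrite (big_ord1_eq _ (fun l => 2 * j.+1%:R * y l.+1)) jN.
rewrite (big_ord1_eq _ (fun l => mu * y l.+1)).
have -> : (if (j.+1 < N)%N then mu * y j.+2 else 0) = mu * y j.+2.
  case: ltnP => // Nj; have -> : j.+2 = N.+1 by lia.
  by rewrite y_last mulr0.
congr (_ + _ + _); case: j jN => [|j] jN.
  by rewrite y_first mulr0 oppr0 big1.
under eq_bigl do rewrite eqSS.
by rewrite (big_ord1_eq _ (fun l => - (mu * y l.+1))) ltnW.
Qed.

End InverseRow.

Lemma norm1_inv_Tmx_le (R : realType) (mu : R) (N : nat) :
  10 < mu -> 2 * mu < N%:R -> norm1 (invmx (Tmx mu N)) <= 7275 / 10000.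
Proof.
move=> mu10 muN; rewrite /norm1; elim/big_ind: _ => [|x y hx hy|i _]; first lra.
  by rewrite ge_max hx.
have mu0 : 0 < mu by lra.
have P := abs_profile mu0 (ltn_ord i) (erefl : inv_row_entry mu i 0 = 0)
  (inv_row_entry_last mu i) (@inv_row_eq _ mu _ i).
apply: le_trans (profile_mass mu0 (ltn_ord i) P mu10 muN); rewrite big_mkord.
by apply: ler_sum => j _; rewrite inv_row_entryE.
Qed.

Unset Implicit Arguments.

Theorem theorem3p22 (R : realType) (mu : R) (hmu : 10 < mu)
    (N : nat) (hNeven : ~~ odd N) (hN : 2 * mu < N%:R) :
  [/\ 10 < mu -> norm1 (invmx (Tmx mu N)) <= 806 / 1000 + 1 / 20,
      100 < mu -> norm1 (invmx (Tmx mu N)) <= 736 / 1000 + 1 / 200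
    & 1000 < mu -> norm1 (invmx (Tmx mu N)) <= 727 / 1000 + 1 / 2000].
Proof.
have bound := norm1_inv_Tmx_le hmu hN.
by split=> _; apply: le_trans bound _; lra.
Qed.
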